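(* Let $X_1,X_2$ be locally convex topological vector (LCTV) spaces, and let $\Omega_i\subset X_i$, $i=1,2$, be nonempty compact convex sets. Consider a function $f\colon\Omega_1\times\Omega_2\to\mathbb{R}$ satisfying the following conditions: (a) $f(\cdot,y)$ is concave and upper semicontinuous (on $\Omega_1$) for every fixed $y\in\Omega_2$; (b) $f(x,\cdot)$ is convex (on $\Omega_2$) for every fixed $x\in\Omega_1$. Then we have the equality $$\max_{x\in\Omega_1}\inf_{y\in\Omega_2}f(x,y)=\inf_{y\in\Omega_2}\max_{x\in\Omega_1}f(x,y).$$
   Context: All vector spaces are over $\mathbb{R}$, and LCTV spaces are assumed Hausdorff. A function $g\colon\Omega\to[-\infty,\infty)$ on a subset $\Omega$ of an LCTV space is upper semicontinuous on $\Omega$ if for each $\alpha\in\mathbb{R}$ the set $\{x\in\Omega\mid g(x)\ge\alpha\}$ is closed in $\Omega$ with the induced topology. Infima are taken in $[-\infty,\infty)$ (they may equal $-\infty$), and the equality is understood in $[-\infty,\infty)$. Writing $\max$ means that the corresponding supremum is attained. *)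

(* Defs.v *)
From HB Require Import structures.
From mathcomp Require Import all_boot all_order all_algebra.
From mathcomp Require Import all_classical all_reals all_analysis.

Set Implicit Arguments.
Unset Strict Implicit.
Unset Printing Implicit Defensive.

Import Order.TTheory GRing.Theory Num.Theory.
Import numFieldNormedType.Exports.

Local Open Scope classical_set_scope.
Local Open Scope ring_scope.
Local Open Scope convex_scope.

(* Counterpart of [convex_function]: the inequality is reversed and, as there,
   only required between points of [D]. *)
Definition concave_function (R : numFieldType) (E : lmodType R)
    (E' := convex_lmodType E) (D : set E') (f : E' -> R^o) :=
  forall t : {i01 R},
    {in D &, forall x y : E', f x <| t |> f y <= f (x <| t |> y)}.

(* [closed] is taken in [subspace D], whose closed subsets of [D] are those of
   the topology induced on [D] (see [closed_subspaceP]); the values of [g]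
   outside [D] are irrelevant. *)
Definition upper_semicontinuous_on (R : realType) (T : topologicalType)
    (D : set T) (g : T -> \bar R) :=
  forall a : R, closed ([set x | D x /\ (a%:E <= g x)%E] : set (subspace D)).

Definition sup_attained (R : realType) (S : set (\bar R)) := S (ereal_sup S).

(* Main.v *)
Require Import Defs.
From HB Require Import structures.
From mathcomp Require Import all_boot all_order all_algebra.
From mathcomp Require Import all_classical all_reals all_analysis.
From mathcomp Require Import finmap ring lra.

(** The inequality sup inf <= inf sup is formal. For the converse let [a] be
the right-hand side, assumed finite. Every [f(., y)] then attains on [O1] a
value [>= a], so each superlevel set [{x in O1 | a <= f x y}] is nonempty; a
point common to all of them makes the left-hand side at least [a] and attains
it. These sets are compact, hence it is enough that finitely many of them meet
([usc_superlevel_fip]).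

Finitely many are treated one at a time ([finite_superlevels_meet]). The
property kept invariant, for a compact convex [C] included in [O1], is that no
[y] in [O2] satisfies [f(., y) < a] on all of [C]. It survives replacing [C] by
[C' = C /\ {a <= f(., y1)}]: if [f(., y) < a] held on [C'], the superlevel sets
of [f(., y1)] and [f(., y)] would be disjoint in [C], and the two-function
alternative [concave_pair_alternative] would give [t] in [[0, 1]] with
[t f(., y1) + (1 - t) f(., y) < a] on [C]; by convexity in [y] the point
[t y1 + (1 - t) y] of [O2] would violate the property for [C].

The alternative is where topology enters. Given concave u.s.c. [g1], [g2] whose
superlevel sets [K1], [K2] at [a] are disjoint, let [Ui] be the set of those [t]
such that [t g1 + (1 - t) g2 < a] on [Ki]. Both are open by compactness of [Ki]
([open_mix_lt]), [0] is in [U1] and [1] is in [U2], and they cover [[0, 1]]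
because concavity would otherwise produce a common point of [K1] and [K2]
([concave_superlevels_meet]). As [[0, 1]] is connected, some [t] lies in both,
and it is the required one: outside of [K1] and [K2] both functions are below
[a] anyway. *)

Set Implicit Arguments.
Unset Strict Implicit.
Unset Printing Implicit Defensive.

Import Order.TTheory GRing.Theory Num.Theory.
Import numFieldNormedType.Exports.

Local Open Scope classical_set_scope.
Local Open Scope ring_scope.

(** * Upper semicontinuous functions on a set *)

Lemma usc_onW (R : realType) (T : topologicalType) (C D : set T)
    (g : T -> \bar R) :
  C `<=` D -> upper_semicontinuous_on D g -> upper_semicontinuous_on C g.
Proof.
move=> CD ug a; have /closed_subspaceP[V cV VD] := ug a.
apply/closed_subspaceP; exists V => //.
have eqV x : (V `&` D) x <-> ([set x | D x /\ (a%:E <= g x)%E] `&` D) x.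
  by rewrite VD.
apply/seteqP; split=> x /=.
  move=> [Vx Cx]; have [[_ ax] _] := (eqV x).1 (conj Vx (CD _ Cx)).
  by split=> //; split.
move=> [[Cx ax] _]; split=> //.
by have [] := (eqV x).2 (conj (conj (CD _ Cx) ax) (CD _ Cx)).
Qed.

(** Trades the subspace topology for a closed set of the ambient space, the form
in which intersections with compact sets are available. *)
Lemma usc_superlevel (R : realType) (T : topologicalType) (D : set T)
    (g : T -> R) (a : R) :
  upper_semicontinuous_on D (fun x => (g x)%:E) ->
  exists2 V : set T, closed V & forall x, D x -> V x <-> a <= g x.
Proof.
move=> ug; have /closed_subspaceP[V cV VD] := ug a.
exists V => // x Dx.
have eqV : (V `&` D) x <-> ([set x | D x /\ (a%:E <= (g x)%:E)%E] `&` D) x.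
  by rewrite VD.
split=> [Vx|ax]; first by have [[_]] := eqV.1 (conj Vx Dx); rewrite lee_fin.
by have [] := eqV.2 (conj (conj Dx ax) Dx).
Qed.

Lemma usc_near (R : realType) (T : topologicalType) (D : set T)
    (g : T -> R) (x : T) (r : R) :
  upper_semicontinuous_on D (fun x => (g x)%:E) -> D x -> g x < r ->
  \forall z \near x, D z -> g z < r.
Proof.
move=> ug Dx gxr; have [V cV VP] := usc_superlevel r ug.
have : nbhs x (~` V).
  apply: open_nbhs_nbhs; split; first exact: closed_openC.
  by move=> /(VP x Dx); rewrite leNgt gxr.
apply: filterS => z nVz Dz; rewrite ltNge; apply/negP => rg.
by apply: nVz; apply/(VP z Dz).
Qed.

Lemma compact_superlevel (R : realType) (T : topologicalType) (D : set T)
    (g : T -> R) (a : R) :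
  compact D -> upper_semicontinuous_on D (fun x => (g x)%:E) ->
  compact (D `&` [set x | a <= g x]).
Proof.
move=> cD ug; have [V cV VP] := usc_superlevel a ug.
rewrite (_ : _ `&` _ = D `&` V); first exact: compact_closedI.
by apply/seteqP; split=> x /= [Dx] /(VP x Dx).
Qed.

(** Letting the level depend on the index serves two purposes: a constant level
gives a point common to the superlevel sets of a family, while the constant
family [g] with the levels [g z] gives a maximum point of [g]. *)
Lemma usc_superlevel_fip (R : realType) (T : topologicalType) (D : set T)
    (I : choiceType) (J : set I) (g : I -> T -> R) (a : I -> R) :
  compact D ->
  (forall i, J i -> upper_semicontinuous_on D (fun x => (g i x)%:E)) ->
  (forall s : seq I, (forall i, i \in s -> J i) ->
     exists2 x, D x & forall i, i \in s -> a i <= g i x) ->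
  exists2 x, D x & forall i, J i -> a i <= g i x.
Proof.
move=> cD ug fip.
have [x0 Dx0 _] := fip [::] (fun i (h : i \in [::]) => False_ind _ (notF h)).
(* [compact_In0] is stated over pointed spaces; a point of [D] serves. *)
pose T' : ptopologicalType := HB.pack T (isPointed.Build T x0).
have [[i0 Ji0]|J0] := pselect (J !=set0); last first.
  by exists x0 => // i Ji; case: J0; exists i.
have cD' : compact (D : set T') by [].
have : \bigcap_(i in J) ((D : set T') `&` [set x | a i <= g i x]) !=set0.
  move: cD'; rewrite compact_In0; apply.
    have /choice[V VP] i : exists V : set T, J i ->
        closed V /\ forall x, D x -> V x <-> a i <= g i x.
      have [Ji|nJi] := pselect (J i); last by exists set0.
      by have [V cV VP] := usc_superlevel (a i) (ug i Ji); exists V.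
    exists V => i Ji; have [cV VE] := VP i Ji => //.
    by apply/seteqP; split=> x /= [Dx] /(VE x Dx).
  move=> s sJ; have [i /sJ|x Dx xs] := fip (s : seq I); first exact: set_mem.
  by exists x => i /xs.
by move=> [x xJ]; exists x; [have [] := xJ _ Ji0|move=> i /xJ[]].
Qed.

(** A maximum point is a common point of the superlevel sets [{g z <= g}] for [z]
in [D]; finitely many of them meet at the best of the corresponding [z]. *)
Lemma usc_has_max (R : realType) (T : topologicalType) (D : set T)
    (g : T -> R) :
  D !=set0 -> compact D -> upper_semicontinuous_on D (fun x => (g x)%:E) ->
  exists2 x, D x & forall z, D z -> g z <= g x.
Proof.
move=> [x0 Dx0] cD ug.
apply: (@usc_superlevel_fip _ _ _ T D (fun=> g) g) => // s.
elim: s => [_|z s IH sD]; first by exists x0.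
have [i si|x Dx xs] := IH; first by apply: sD; rewrite inE si orbT.
have Dz : D z by apply: sD; rewrite mem_head.
have [zx|xz] := leP (g z) (g x).
  by exists x => // i; rewrite inE => /predU1P[->//|/xs].
exists z => // i; rewrite inE => /predU1P[->//|/xs ix].
exact: le_trans ix (ltW xz).
Qed.

(** * The alternative for two concave functions *)

(** A strict inequality at [(s, x)] persists for [t] near [s] and [z] near [x]:
half of the slack goes to moving [x], where each function exceeds its value by
less than [e], and the rest to moving [t]. Compactness of [K] makes the
neighbourhood of [s] uniform in [x]. The premise [0 <= t <= 1] keeps the weights
nonnegative, so that upper bounds on [g1] and [g2] combine; it also makes the
set contain everything outside [[0, 1]], whence it is open in the whole line. *)
Lemma open_mix_lt (R : realType) (T : topologicalType) (K : set T)
    (g1 g2 : T -> R) (a : R) :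
  compact K -> upper_semicontinuous_on K (fun x => (g1 x)%:E) ->
  upper_semicontinuous_on K (fun x => (g2 x)%:E) ->
  open [set t : R | 0 <= t <= 1 ->
    forall x, K x -> t * g1 x + (1 - t) * g2 x < a].
Proof.
move=> /compact_near_coveringP cK u1 u2; rewrite openE => s /= sP.
rewrite /interior.
have [s01|ns01] := boolP (0 <= s <= 1); last first.
  have : nbhs s (~` `[0 : R, 1]).
    apply: open_nbhs_nbhs; split; first exact/closed_openC/itv_closed.
    by rewrite /= in_itv /=; exact/negP.
  by apply: filterS => t /=; rewrite in_itv.
pose P (t : R) x := K x -> 0 <= t <= 1 -> t * g1 x + (1 - t) * g2 x < a.
suff : \forall t \near s, K `<=` P t.
  by apply: filterS => t tP t01 x Kx; exact: tP.
apply: (cK R (nbhs s) P) => x Kx; have xs := sP s01 x Kx.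
pose e := (a - (s * g1 x + (1 - s) * g2 x)) / 2.
have e0 : 0 < e by rewrite /e; lra.
have g1e : g1 x < g1 x + e by rewrite ltrDl.
have g2e : g2 x < g2 x + e by rewrite ltrDl.
have n1 := usc_near u1 Kx g1e.
have n2 := usc_near u2 Kx g2e.
have nt : \forall t \near s, t * (g1 x + e) + (1 - t) * (g2 x + e) < a.
  have ct : (fun t : R => t * (g1 x + e) + (1 - t) * (g2 x + e)) @ s -->
      s * (g1 x + e) + (1 - s) * (g2 x + e).
    apply: cvgD; first by apply: cvgM; [exact: cvg_id|exact: cvg_cst].
    apply: cvgM; last exact: cvg_cst.
    by apply: cvgB; [exact: cvg_cst|exact: cvg_id].
  have lts : s * (g1 x + e) + (1 - s) * (g2 x + e) < a by rewrite /e; lra.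
  exact: (cvgr_lt _ ct _ lts).
near=> z t => /= Kz /andP[t0 t1].
have g1z : g1 z < g1 x + e by apply: (near n1 z).
have g2z : g2 z < g2 x + e by apply: (near n2 z).
have ta : t * (g1 x + e) + (1 - t) * (g2 x + e) < a by near: t.
apply: le_lt_trans ta.
by rewrite lerD// ler_wpM2l ?subr_ge0// ltW.
Unshelve. all: by end_near. Qed.

Lemma convex_superlevel (R : realType) (E : tvsType R) (C : set E)
    (g : E -> R) (a : R) :
  convex_set C -> concave_function C g ->
  convex_set (C `&` [set x | a <= g x]).
Proof.
move=> cvC cvg x y t /set_mem[Cx /= ax] /set_mem[Cy /= ay].
apply/mem_set; split => /=; first by apply/set_mem/cvC; exact/mem_set.
apply: le_trans (cvg t x y (mem_set Cx) (mem_set Cy)).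
rewrite convRE (_ : a = t%:num * a + (1 - t%:num) * a); last by ring.
by rewrite lerD// ler_wpM2l// subr_ge0.
Qed.

(** In the plane of values [(g1, g2)], the two points lie in the half-plane
[a <= t u + (1 - t) v], one on each side of the line [u = a]. The segment joining
them crosses that line inside the half-plane, hence at height at least [a];
concavity only moves the value at the crossing further up. *)
Lemma concave_superlevels_meet (R : realType) (E : tvsType R) (C : set E)
    (g1 g2 : E -> R) (a t : R) (x1 x2 : E) :
  convex_set C -> concave_function C g1 -> concave_function C g2 ->
  C x1 -> C x2 -> 0 <= t <= 1 ->
  a <= g1 x1 -> g1 x2 < a ->
  a <= t * g1 x1 + (1 - t) * g2 x1 -> a <= t * g1 x2 + (1 - t) * g2 x2 ->
  exists2 z, C z & a <= g1 z /\ a <= g2 z.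
Proof.
move=> cvC cv1 cv2 C1 C2 /andP[t0 t1] a1 a2 m1 m2.
have d0 : 0 < g1 x1 - g1 x2 by rewrite subr_gt0; exact: lt_le_trans a2 a1.
(* The parameter at which the segment crosses the line [u = a]. *)
pose l := (a - g1 x2) / (g1 x1 - g1 x2).
have l0 : 0 <= l by rewrite /l divr_ge0 ?ltW// subr_gt0.
have l1 : l <= 1 by rewrite /l ler_pdivrMr// mul1r lerB.
have lE : l * g1 x1 + (1 - l) * g1 x2 = a by rewrite /l; field; rewrite gt_eqF.
pose z : E := conv (Itv01 l0 l1) (x1 : convex_lmodType E) x2.
have Cz : C z by apply/set_mem/cvC; exact/mem_set.
have g1z : l * g1 x1 + (1 - l) * g1 x2 <= g1 z.
  exact: (cv1 (Itv01 l0 l1) x1 x2 (mem_set C1) (mem_set C2)).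
have g2z : l * g2 x1 + (1 - l) * g2 x2 <= g2 z.
  exact: (cv2 (Itv01 l0 l1) x1 x2 (mem_set C1) (mem_set C2)).
exists z => //; split; first by rewrite -lE.
apply: le_trans g2z.
(* For [t = 1] the half-plane would be [a <= u], which excludes [x2]. *)
have t1' : 0 < 1 - t.
  rewrite subr_gt0 lt_neqAle t1 andbT; apply/eqP => te.
  by move: m2; rewrite te subrr mul0r addr0 mul1r leNgt a2.
rewrite -(ler_pM2l t1').
have h1 := ler_wpM2l l0 m1.
have h2 : (1 - l) * a <= (1 - l) * (t * g1 x2 + (1 - t) * g2 x2).
  by rewrite ler_wpM2l// subr_ge0.
have h3 : t * (l * g1 x1 + (1 - l) * g1 x2) = t * a by rewrite lE.
lra.
Qed.

(** A theorem of the alternative obtained from the connectedness of [[0, 1]]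
instead of separation of convex sets: if no [t] works, the two open sets of
weights [U K1] and [U K2], which cover [[0, 1]], are disjoint there, so each is
also the complement of the other and [U K1] is clopen in [[0, 1]]. *)
Lemma concave_pair_alternative (R : realType) (E : tvsType R) (C : set E)
    (g1 g2 : E -> R) (a : R) :
  compact C -> convex_set C ->
  concave_function C g1 -> concave_function C g2 ->
  upper_semicontinuous_on C (fun x => (g1 x)%:E) ->
  upper_semicontinuous_on C (fun x => (g2 x)%:E) ->
  (exists2 x, C x & a <= g1 x /\ a <= g2 x) \/
  (exists2 t : R, 0 <= t <= 1 &
     forall x, C x -> t * g1 x + (1 - t) * g2 x < a).
Proof.
move=> cC cvC cv1 cv2 u1 u2.
have [|no_meet] := pselect (exists2 x, C x & a <= g1 x /\ a <= g2 x).
  by left.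
right; apply: contrapT => no_t.
pose K1 := C `&` [set x | a <= g1 x].
pose K2 := C `&` [set x | a <= g2 x].
have K1C : K1 `<=` C by move=> x [].
have K2C : K2 `<=` C by move=> x [].
pose U (K : set E) := [set t : R | 0 <= t <= 1 ->
  forall x, K x -> t * g1 x + (1 - t) * g2 x < a].
have oU1 : open (U K1).
  by apply: open_mix_lt; [exact: compact_superlevel|exact: usc_onW u1|
                          exact: usc_onW u2].
have oU2 : open (U K2).
  by apply: open_mix_lt; [exact: compact_superlevel|exact: usc_onW u1|
                          exact: usc_onW u2].
have U12 (t : R) : 0 <= t <= 1 -> U K1 t -> ~ U K2 t.
  move=> t01 U1 U2; apply: no_t; exists t => // x Cx.
  have [ag1|g1a] := leP a (g1 x); first exact: U1.
  have [ag2|g2a] := leP a (g2 x); first exact: U2.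
  move: t01 => /andP[t0 t1]; have m1 : 0 <= 1 - t by rewrite subr_ge0.
  have := ler_wpM2l t0 (ltW g1a); have := ler_wpM2l m1 (ltW g2a).
  have [->|tn0] := eqVneq t 0; first lra.
  have := ltr_pM2l (_ : 0 < t); rewrite lt_neqAle eq_sym tn0 t0 => /(_ isT).
  by move=> tM; move: g1a; rewrite -tM; lra.
have U21 (t : R) : 0 <= t <= 1 -> ~ U K2 t -> U K1 t.
  move=> t01 nU2 _ x1 [Cx1 /= ag1]; rewrite ltNge; apply/negP => m1.
  apply: nU2 => _ x2 [Cx2 /= ag2]; rewrite ltNge; apply/negP => m2.
  have g12 : g1 x2 < a.
    by rewrite ltNge; apply/negP => ag12; apply: no_meet; exists x2.
  exact/no_meet/(concave_superlevels_meet cvC cv1 cv2 Cx1 Cx2 t01).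
have one01 : 0 <= (1 : R) <= 1 by rewrite lexx ler01.
pose I01 : set R := [set` `[0 : R, 1]].
have segU : I01 `&` U K1 = I01.
  apply: (@segment_connected R 0 1).
  - exists 0; split; first by rewrite /I01 /= in_itv /= lexx ler01.
    move=> _ x [Cx /= ag1]; rewrite mul0r add0r subr0 mul1r ltNge.
    by apply/negP => ag2; apply: no_meet; exists x.
  - by exists (U K1).
  - exists (~` U K2); first exact: open_closedC.
    apply/seteqP; split=> t [t01] Ut; split=> //; move: t01.
      by rewrite /I01 /= in_itv => t01; exact: U12.
    by rewrite /I01 /= in_itv => t01; exact: U21.
have U11 : U K1 1.
  have : I01 1 by rewrite /I01 /= in_itv.
  by rewrite -segU => -[].
apply: (U12 1 one01 U11) => _ x [Cx /= ag2].
rewrite subrr mul0r addr0 mul1r ltNge.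
by apply/negP => ag1; apply: no_meet; exists x.
Qed.

(** * From finitely many superlevel sets to the minimax equality *)

(** Induction on [s] with [C] varying: the head of [s] is absorbed by shrinking
[C] to one of its superlevel sets, and the alternative shows that the premise on
[C] is inherited. The set [O1] stays fixed because the hypotheses on [f] live
there. *)
Lemma finite_superlevels_meet (R : realType) (X1 : tvsType R) (X2 : lmodType R)
    (O1 C : set X1) (O2 : set X2) (f : X1 -> X2 -> R) (a : R) (s : seq X2) :
  C `<=` O1 -> compact C -> convex_set C -> convex_set O2 -> O2 !=set0 ->
  (forall y, O2 y -> concave_function O1 (fun x => f x y)) ->
  (forall y, O2 y -> upper_semicontinuous_on O1 (fun x => (f x y)%:E)) ->
  (forall x, O1 x -> convex_function O2 (f x)) ->
  (forall y, O2 y -> exists2 x, C x & a <= f x y) ->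
  (forall y, y \in s -> O2 y) ->
  exists2 x, C x & forall y, y \in s -> a <= f x y.
Proof.
move=> + + + cvO2 [y0 O2y0] fcv fusc fcx.
elim: s C => [|y1 s IH] C CO cC cvC aC sO2.
  by have [x Cx _] := aC _ O2y0; exists x.
have O2y1 : O2 y1 by apply: sO2; rewrite mem_head.
have fcvC y : O2 y -> concave_function C (fun x => f x y).
  move=> O2y t x x' /set_mem Cx /set_mem Cx'.
  by apply: fcv => //; apply/mem_set; exact: CO.
have fuscC y : O2 y -> upper_semicontinuous_on C (fun x => (f x y)%:E).
  by move=> O2y; apply: usc_onW CO _; exact: fusc.
have [||||x|x [Cx /= ax] xs] := IH (C `&` [set x | a <= f x y1]).
- by move=> x [/CO].
- exact: compact_superlevel (fuscC _ O2y1).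
- exact: convex_superlevel cvC (fcvC _ O2y1).
- move=> y O2y.
  have [[x Cx [ax1 ax]]|[t /andP[t0 t1] tP]] := concave_pair_alternative
    a cC cvC (fcvC _ O2y1) (fcvC _ O2y) (fuscC _ O2y1) (fuscC _ O2y).
    by exists x.
  pose z : X2 := conv (Itv01 t0 t1) (y1 : convex_lmodType X2) y.
  have O2z : O2 z by apply/set_mem/cvO2; exact/mem_set.
  have [x Cx] := aC z O2z; rewrite leNgt => /negP[].
  have fz : f x z <= t * f x y1 + (1 - t) * f x y.
    exact: (fcx x (CO _ Cx) (Itv01 t0 t1) y1 y (mem_set O2y1) (mem_set O2y)).
  exact: le_lt_trans fz (tP x Cx).
- by move=> xs; apply: sO2; rewrite inE xs orbT.
by exists x => // y; rewrite inE => /predU1P[->//|/xs].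
Qed.

Theorem theorem5p1 (R : realType) (X1 X2 : tvsType R)
  (hX1 : hausdorff_space X1) (hX2 : hausdorff_space X2)
  (O1 : set X1) (O2 : set X2)
  (O1_neq0 : O1 !=set0) (O1_compact : compact O1) (O1_convex : convex_set O1)
  (O2_neq0 : O2 !=set0) (O2_compact : compact O2) (O2_convex : convex_set O2)
  (f : X1 -> X2 -> R)
  (f_concave : forall y, O2 y -> concave_function O1 (fun x => f x y))
  (f_usc : forall y, O2 y -> upper_semicontinuous_on O1 (fun x => (f x y)%:E))
  (f_convex : forall x, O1 x -> convex_function O2 (f x)) :
  [/\ sup_attained [set ereal_inf [set (f x y)%:E | y in O2] | x in O1],
      (forall y, O2 y -> sup_attained [set (f x y)%:E | x in O1]) &
      ereal_sup [set ereal_inf [set (f x y)%:E | y in O2] | x in O1] =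
      ereal_inf [set ereal_sup [set (f x y)%:E | x in O1] | y in O2]].
Proof.
set v := ereal_inf [set ereal_sup _ | y in O2].
have maxP y : O2 y -> exists2 x, O1 x &
    ereal_sup [set (f x y)%:E | x in O1] = (f x y)%:E.
  move=> O2y; have [x Ox xmax] := usc_has_max O1_neq0 O1_compact (f_usc y O2y).
  exists x => //; apply/eqP; rewrite eq_le; apply/andP; split.
    by apply: ge_ereal_sup => _ [z Oz <-]; rewrite lee_fin xmax.
  by apply: ereal_sup_ubound; exists x.
have infv x : O1 x -> (ereal_inf [set (f x y)%:E | y in O2] <= v)%E.
  move=> Ox; apply: le_ereal_inf_tmp => _ [y O2y <-].
  apply: (@le_trans _ _ (f x y)%:E); first by apply: ereal_inf_lbound; exists y.
  by apply: ereal_sup_ubound; exists x.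
have [x Ox vx] : exists2 x, O1 x &
    (v <= ereal_inf [set (f x y)%:E | y in O2])%E.
  case: v infv (@ereal_inf_lbound _ _ : lbound _ v) => [a| |] infv vlb.
  - have aP y : O2 y -> exists2 x, O1 x & a <= f x y.
      move=> O2y; have [x Ox xE] := maxP y O2y; exists x => //.
      by rewrite -lee_fin -xE; apply: vlb; exists y.
    have [x Ox xP] := usc_superlevel_fip (a := fun=> a) O1_compact f_usc
      (fun s sO2 => finite_superlevels_meet (@subset_refl _ O1) O1_compact O1_convex
        O2_convex O2_neq0 f_concave f_usc f_convex aP sO2).
    exists x => //; apply: le_ereal_inf_tmp => _ [y O2y <-].
    by rewrite lee_fin; exact: xP.
  - have [y O2y] := O2_neq0; have [x Ox xE] := maxP y O2y.
    by have := vlb _ (ex_intro2 _ _ y O2y erefl); rewrite xE leye_eq.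
  - by have [x Ox] := O1_neq0; exists x => //; rewrite leNye.
have supv : ereal_sup [set ereal_inf [set (f x y)%:E | y in O2] | x in O1] = v.
  apply/eqP; rewrite eq_le; apply/andP; split.
    by apply: ge_ereal_sup => _ [z Oz <-]; exact: infv.
  by apply: le_trans vx _; apply: ereal_sup_ubound; exists x.
split => //.
- rewrite /sup_attained supv; exists x => //.
  by apply/eqP; rewrite eq_le infv.
- by move=> y O2y; rewrite /sup_attained; have [z Oz ->] := maxP y O2y; exists z.
Qed.
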